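(* Let $W\in\mathbb{R}^{n\times n}$ be symmetric positive definite, let $T\in\mathbb{R}^{n\times n}$ be symmetric, indefinite and nonsingular, and let $A=W+\mathrm{i}T$. Let $\lambda_{\max}$ be the largest eigenvalue of $W$ and let $\mu_{\min}>0$ be the smallest absolute value of an eigenvalue of $T$. For $\alpha>0$ put $$G(\alpha)=\mathrm{i}\,T^{-1}W(\alpha I+W)^{-1}(\alpha I-\mathrm{i}T),\qquad \sigma(\alpha)=\frac{\lambda_{\max}}{\alpha+\lambda_{\max}}\cdot\frac{\sqrt{\alpha^{2}+\mu_{\min}^{2}}}{\mu_{\min}}.$$ Then the spectral radius satisfies $\rho(G(\alpha))\le\sigma(\alpha)$ for every $\alpha>0$. Furthermore: (i) If $\lambda_{\max}\le\mu_{\min}$, then $\sigma(\alpha)<1$ for every $\alpha>0$, and hence the LHSS iteration is convergent for every $\alpha>0$. (ii) If $\lambda_{\max}>\mu_{\min}$, then, for $\alpha>0$, $\sigma(\alpha)<1$ if and only if $$\alpha\in\left(0,\frac{2\lambda_{\max}\mu_{\min}^{2}}{\lambda_{\max}^{2}-\mu_{\min}^{2}}\right),$$ and hence the LHSS iteration is convergent for every such $\alpha$.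
   Context: A real symmetric matrix is indefinite if it has at least one positive and at least one negative eigenvalue. For $b\in\mathbb{C}^n$, the LHSS iteration with parameter $\alpha>0$ for the system $Ax=b$ is, from an initial vector $x^{(0)}\in\mathbb{C}^n$ and for $k=0,1,2,\dots$, $$(\alpha I+W)x^{(k+1/2)}=(\alpha I-\mathrm{i}T)x^{(k)}+b,\qquad Tx^{(k+1)}=\mathrm{i}Wx^{(k+1/2)}-\mathrm{i}b.$$ Its iteration matrix (the matrix multiplying $x^{(k)}$ in the expression for $x^{(k+1)}$) is $G(\alpha)$. The iteration is called convergent if for all $b$ and $x^{(0)}$ the sequence $x^{(k)}$ converges to the unique solution of $Ax=b$. $\rho$ denotes the spectral radius. *)

(* Defs.v *)
From HB Require Import structures.
From mathcomp Require Import all_boot all_order all_algebra.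
From mathcomp Require Import all_classical all_reals all_analysis.
From mathcomp Require Import complex.

Set Implicit Arguments.
Unset Strict Implicit.
Unset Printing Implicit Defensive.

Import Order.TTheory GRing.Theory Num.Theory.
Import numFieldNormedType.Exports.

Local Open Scope classical_set_scope.
Local Open Scope ring_scope.

Definition sym_posdef (R : realType) (n : nat) (W : 'M[R]_n) : Prop :=
  W \is symmetricmx /\
  forall x : 'cV[R]_n, x != 0 -> 0 < (x^T *m W *m x) 0 0.

Definition sym_indefinite (R : realType) (n : nat) (T : 'M[R]_n) : Prop :=
  [/\ T \is symmetricmx,
      (exists2 a, eigenvalue T a & 0 < a) &
      (exists2 a, eigenvalue T a & a < 0)].

Definition largest_eigenvalue (R : realType) (n : nat) (W : 'M[R]_n) (l : R)
    : Prop :=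
  eigenvalue W l /\ forall a, eigenvalue W a -> a <= l.

Definition smallest_abs_eigenvalue (R : realType) (n : nat) (T : 'M[R]_n)
    (m : R) : Prop :=
  (exists2 a, eigenvalue T a & `|a| = m) /\
  forall a, eigenvalue T a -> m <= `|a|.

(* The set of eigenvalues is finite, and nonempty when 0 < n, so this supremum
   is a maximum. *)
Definition spectral_radius (R : realType) (n : nat) (G : 'M[R[i]]_n) : R :=
  sup [set Normc.normc z | z in [set z : R[i] | eigenvalue G z]].

Definition cmx (R : realType) (m n : nat) (M : 'M[R]_(m, n)) : 'M[R[i]]_(m, n) :=
  map_mx (real_complex R) M.

Definition lhss_matrix (R : realType) (n : nat) (W T : 'M[R]_n) : 'M[R[i]]_n :=
  cmx W + 'i%C *: cmx T.

Definition lhss_G (R : realType) (n : nat) (W T : 'M[R]_n) (alpha : R)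
    : 'M[R[i]]_n :=
  'i%C *: (invmx (cmx T) *m cmx W *m invmx (cmx (alpha%:M + W)) *m
           (cmx alpha%:M - 'i%C *: cmx T)).

(* [xh k] is the intermediate iterate x^(k+1/2). *)
Definition lhss_iterates (R : realType) (n : nat) (W T : 'M[R]_n) (alpha : R)
    (b x0 : 'cV[R[i]]_n) (x xh : nat -> 'cV[R[i]]_n) : Prop :=
  x 0%N = x0 /\
  forall k : nat,
    cmx (alpha%:M + W) *m xh k = (cmx alpha%:M - 'i%C *: cmx T) *m x k + b /\
    cmx T *m x k.+1 = 'i%C *: (cmx W *m xh k) - 'i%C *: b.

(* Existence of the iterates is required as well, so that convergence cannot
   hold vacuously.  The alias [R[i]^o] is what carries the topology given by
   the modulus. *)
Definition lhss_convergent (R : realType) (n : nat) (W T : 'M[R]_n) (alpha : R)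
    : Prop :=
  forall b x0 : 'cV[R[i]]_n,
    exists xs : 'cV[R[i]]_n,
      [/\ unique (fun y => lhss_matrix W T *m y = b) xs,
          (exists x xh, lhss_iterates W T alpha b x0 x xh) &
          forall x xh, lhss_iterates W T alpha b x0 x xh ->
            x @ \oo --> (xs : 'cV[R[i]^o]_n)].

Definition lhss_sigma (R : realType) (lmax mmin alpha : R) : R :=
  lmax / (alpha + lmax) * (Num.sqrt (alpha ^+ 2 + mmin ^+ 2) / mmin).

(* Main.v *)
(** With [f] the half-step error, one LHSS sweep takes the error [e] to [e']
    where [(alpha + W) f = (alpha - i T) e] and [T e' = i W f].  Diagonalizing
    [W] gives [|W f| <= lmax / (alpha + lmax) |(alpha + W) f|] and diagonalizing
    [T] gives [|(alpha - i T) e| <= sqrt (alpha^2 + mmin^2) / mmin |T e|], so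
    [|T e'| <= sigma |T e|] in the Euclidean norm.  The case [e' = z e] bounds
    the eigenvalues of [G]; iterating the bound gives convergence; and a kernel
    vector of [A] is a case [e' = e], whence [A] is invertible if [sigma < 1]. *)

Require Import Defs.
From mathcomp Require Import all_boot all_order all_algebra.
From mathcomp Require Import all_classical all_reals all_analysis.
From mathcomp Require Import complex.
From mathcomp Require Import ring lra.

Set Implicit Arguments.
Unset Strict Implicit.
Unset Printing Implicit Defensive.

Import Order.TTheory GRing.Theory Num.Theory.
Import numFieldNormedType.Exports.
Local Open Scope ring_scope.

(** * Moduli and the squared Euclidean norm of complex vectors *)

Lemma normc_sqr (R : realType) (z : R[i]) :
  Normc.normc z ^+ 2 = complex.Re z ^+ 2 + complex.Im z ^+ 2.
Proof. by case: z => a b /=; rewrite sqr_sqrtr // addr_ge0 ?sqr_ge0. Qed.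

Lemma normc_ge0 (R : realType) (z : R[i]) : 0 <= Normc.normc z.
Proof. by case: z => a b /=; rewrite sqrtr_ge0. Qed.

(** [eigenvalue] speaks of row eigenvectors; this gives access to column ones. *)
Lemma eigenvalue_trmx (F : fieldType) (n : nat) (A : 'M[F]_n) (a : F) :
  eigenvalue A^T a = eigenvalue A a.
Proof.
rewrite /eigenvalue /eigenspace !kermx_eq0 !row_free_unit -unitmx_tr.
by rewrite linearB /= trmxK tr_scalar_mx.
Qed.

Definition sqnorm (R : realType) (n : nat) (v : 'cV[R[i]]_n) : R :=
  \sum_i Normc.normc (v i 0) ^+ 2.

Lemma sqnorm_ge0 (R : realType) (n : nat) (v : 'cV[R[i]]_n) : 0 <= sqnorm v.
Proof. by apply: sumr_ge0 => i _; rewrite sqr_ge0. Qed.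

Lemma normc_sqr_le_sqnorm (R : realType) (n : nat) (v : 'cV[R[i]]_n) i :
  Normc.normc (v i 0) ^+ 2 <= sqnorm v.
Proof.
rewrite /sqnorm (bigD1 i) //= lerDl; apply: sumr_ge0 => j _; exact: sqr_ge0.
Qed.

Lemma sqnorm_eq0 (R : realType) (n : nat) (v : 'cV[R[i]]_n) :
  sqnorm v = 0 -> v = 0.
Proof.
move=> v0; apply/matrixP => i j; rewrite (ord1 j) mxE; apply: Normc.eq0_normc.
apply/eqP; rewrite -sqrf_eq0 eq_le sqr_ge0 andbT -v0.
exact: normc_sqr_le_sqnorm.
Qed.

Lemma sqnormZ (R : realType) (n : nat) (a : R[i]) (v : 'cV[R[i]]_n) :
  sqnorm (a *: v) = Normc.normc a ^+ 2 * sqnorm v.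
Proof.
rewrite /sqnorm mulr_sumr; apply: eq_bigr => i _.
by rewrite mxE Normc.normcM exprMn.
Qed.

Lemma sqnormE (R : realType) (n : nat) (v : 'cV[R[i]]_n) :
  real_complex R (sqnorm v) = (map_mx Num.conj v^T *m v) 0 0.
Proof.
rewrite mxE rmorph_sum; apply: eq_bigr => i _; rewrite !mxE rmorphXn /=.
by rewrite mulrC -normCK; congr (_ ^+ 2); case: (v i 0).
Qed.

Lemma sqnorm_unitary (R : realType) (n : nat) (P : 'M[R[i]]_n)
    (v : 'cV[R[i]]_n) : P \is unitarymx -> sqnorm (P *m v) = sqnorm v.
Proof.
move=> uP; apply: (@complexI R); rewrite !sqnormE trmx_mul map_mxM mulmxA.
rewrite -(mulmxA (map_mx _ v^T)) -(invmx_unitary uP) mulVmx ?mulmx1 //.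
exact: unitarymx_unit.
Qed.

(** Unitary diagonalization [P] of [M]: [d] lists the eigenvalues and [c i] is the squared modulus
    of coordinate [i] of [P *m v]. Neither depends on [a] or [b], so the norms of two affine
    expressions in [M] applied to the same [v] can be compared eigenvalue by eigenvalue. *)
Lemma sqnorm_affine_sym (R : realType) (n : nat) (M : 'M[R]_n)
    (v : 'cV[R[i]]_n) : M \is symmetricmx ->
  exists d c : 'I_n -> R,
    [/\ forall i, eigenvalue M (d i), forall i, 0 <= c i &
        forall a b : R[i],
          sqnorm ((a%:M + b *: cmx M) *m v) =
          \sum_i Normc.normc (a + b * real_complex R (d i)) ^+ 2 * c i].
Proof.
move=> symM.
have hM : cmx M \is hermsymmx.
  apply: realsym_hermsym.
    apply/is_hermitianmxP; have /is_hermitianmxP := symM.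
    rewrite /cmx expr0 !scale1r !map_mx_id // => {1}->.
    by rewrite map_trmx.
  by apply/mxOverP => i j; rewrite mxE complex_real.
have /orthomx_spectralP := hermitian_normalmx hM.
have /mxOverP := hermitian_spectral_diag_real hM.
have := spectral_unitarymx (cmx M).
set P := spectralmx _; set s := spectral_diag _ => uP sreal eqM.
have PU : P \in unitmx by exact: unitarymx_unit.
have sE i : s 0 i = real_complex R (complex.Re (s 0 i)).
  by rewrite RRe_real.
have PM : P *m cmx M = diag_mx s *m P.
  by rewrite {1}eqM !mulmxA mulmxV // mul1mx.
exists (fun i => complex.Re (s 0 i)), (fun i => Normc.normc ((P *m v) i 0) ^+ 2).
split=> [i|i|a b]; last 1 first.
- rewrite -(sqnorm_unitary _ uP) mulmxA mulmxDr -scalemxAr PM.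
  have -> : P *m a%:M = a%:M *m P by rewrite scalar_mxC.
  rewrite scalemxAl -mulmxDl -mulmxA /sqnorm; apply: eq_bigr => i _.
  rewrite -diag_const_mx -linearZ -raddfD /= mul_diag_mx !mxE.
  by rewrite Normc.normcM exprMn {1}sE.
(* Row [i] of [P] is an eigenvector of the complexified [M]; its eigenvalue is real, hence an
   eigenvalue of [M] over [R]. *)
- rewrite -(eigenvalue_map (real_complex R)) -[_ (complex.Re _)]sE.
  apply/eigenvalueP; exists (row i P).
    rewrite -row_mul -[map_mx _ M]/(cmx M) PM row_mul row_diag_mx.
    by rewrite -scalemxAl -rowE.
  (* A zero row would make a diagonal entry of the product of [P] with its adjoint vanish instead of
     being 1. *)
  apply/negP => /eqP P0; have /unitarymxP /(congr1 (row i)) := uP.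
  rewrite row_mul P0 mul0mx => /rowP /(_ i); rewrite !mxE eqxx.
  by move/eqP; rewrite eq_sym oner_eq0.
- exact: sqr_ge0.
Qed.

(** * Signs of eigenvalues and invertibility *)

Lemma posdef_eigenvalue_gt0 (R : realType) (n : nat) (W : 'M[R]_n) (a : R) :
  sym_posdef W -> eigenvalue W a -> 0 < a.
Proof.
move=> [_ posW] /eigenvalueP [v vW v0].
have vT0 : v^T != 0 by rewrite -trmx0 (inj_eq trmx_inj).
have := posW _ vT0; rewrite trmxK vW -scalemxAl mxE pmulr_lgt0 //.
rewrite lt_neqAle mxE [X in _ && X]sumr_ge0 => [|j _]; last first.
  by rewrite mxE -expr2 sqr_ge0.
rewrite andbT eq_sym; apply/negP => /eqP s0; case/negP: v0; apply/eqP/rowP => j.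
rewrite mxE; apply/eqP; rewrite -sqrf_eq0; apply/eqP.
move/psumr_eq0P: s0 => /(_ _ j isT); rewrite mxE -expr2; apply=> k _.
by rewrite mxE -expr2 sqr_ge0.
Qed.

Lemma unitmx_eigenvalue_neq0 (F : fieldType) (n : nat) (M : 'M[F]_n) (a : F) :
  M \in unitmx -> eigenvalue M a -> a != 0.
Proof.
move=> MU; apply: contraL => /eqP ->.
rewrite /eigenvalue /eigenspace negbK kermx_eq0 row_free_unit.
by rewrite raddf0 subr0.
Qed.

Lemma posdef_shift_unitmx (R : realType) (n : nat) (W : 'M[R]_n) (alpha : R) :
  sym_posdef W -> 0 < alpha -> alpha%:M + W \in unitmx.
Proof.
move=> posW al0; rewrite -row_free_unit -kermx_eq0.
(* A singular [alpha%:M + W] would have the negative number [- alpha] as an eigenvalue of [W]. *)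
have := @posdef_eigenvalue_gt0 _ _ W (- alpha) posW.
rewrite oppr_gt0 ltNge (ltW al0) /= /eigenvalue /eigenspace rmorphN opprK addrC.
by case: (_ == 0) => // /(_ isT).
Qed.

(** * Norm estimates for one sweep *)

Section Step.

Variables (R : realType) (n : nat) (W T : 'M[R]_n) (l m alpha : R).
Hypotheses (symW : W \is symmetricmx) (symT : T \is symmetricmx).
Hypotheses (l0 : 0 <= l) (m0 : 0 < m) (al0 : 0 < alpha).
Hypothesis eigW : forall a, eigenvalue W a -> 0 <= a <= l.
Hypothesis eigT : forall a, eigenvalue T a -> m <= `|a|.

Let eigT_sqr a : eigenvalue T a -> m ^+ 2 <= a ^+ 2.
Proof.
by move=> /eigT ma; rewrite -[leRHS]real_normK ?num_real // ler_pXn2r ?nnegrE // ltW.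
Qed.

(** The quotient [d / (alpha + d)] increases with [d >= 0], so it is largest at [d = l]. *)
Lemma sqnorm_posdef_shift (f : 'cV[R[i]]_n) :
  (alpha + l) ^+ 2 * sqnorm (cmx W *m f) <=
  l ^+ 2 * sqnorm (cmx (alpha%:M + W) *m f).
Proof.
have [d [c [eigd c0 dE]]] := sqnorm_affine_sym f symW.
have := dE 0 1; rewrite raddf0 add0r scale1r => ->.
have := dE (real_complex R alpha) 1.
rewrite scale1r -map_scalar_mx -map_mxD => ->.
rewrite !mulr_sumr; apply: ler_sum => i _.
rewrite ![_ * (_ * c i)]mulrA ler_wpM2r //.
have /eigW /andP[di0 dil] := eigd i.
rewrite !normc_sqr /=.
rewrite [leLHS](_ : _ = ((alpha + l) * d i) ^+ 2); last by ring.
rewrite [leRHS](_ : _ = (l * (alpha + d i)) ^+ 2); last by ring.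
rewrite ler_pXn2r ?nnegrE //; first by have := ler_wpM2l (ltW al0) dil; lra.
- by rewrite mulr_ge0 // addr_ge0 // ltW.
- by rewrite mulr_ge0 // addr_ge0 // ltW.
Qed.

(** The quotient [(alpha ^+ 2 + d ^+ 2) / d ^+ 2] decreases in [|d|], so it is largest at
    [|d| = m]. *)
Lemma sqnorm_shift_imaginary (e : 'cV[R[i]]_n) :
  m ^+ 2 * sqnorm ((cmx alpha%:M - 'i%C *: cmx T) *m e) <=
  (alpha ^+ 2 + m ^+ 2) * sqnorm (cmx T *m e).
Proof.
have [d [c [eigd c0 dE]]] := sqnorm_affine_sym e symT.
have := dE 0 1; rewrite raddf0 add0r scale1r => ->.
have := dE (real_complex R alpha) (- 'i%C).
rewrite scaleNr -map_scalar_mx => ->.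
rewrite !mulr_sumr; apply: ler_sum => i _.
rewrite ![_ * (_ * c i)]mulrA ler_wpM2r //.
have mdi := eigT_sqr (eigd i).
rewrite !normc_sqr /=; have := sqr_ge0 alpha; nra.
Qed.

(** Turns decay of [T] applied to the error into decay of the error itself. *)
Lemma sqnorm_symmetric_ge (e : 'cV[R[i]]_n) :
  m ^+ 2 * sqnorm e <= sqnorm (cmx T *m e).
Proof.
have [d [c [eigd c0 dE]]] := sqnorm_affine_sym e symT.
have := dE 0 1; rewrite raddf0 add0r scale1r => ->.
have := dE 1 0; rewrite scale0r addr0 mul1mx => ->.
rewrite !mulr_sumr; apply: ler_sum => i _.
rewrite ![_ * (_ * c i)]mulrA ler_wpM2r //.
have mdi := eigT_sqr (eigd i).
by rewrite !normc_sqr /=; nra.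
Qed.

Lemma lhss_sigma_ge0 : 0 <= lhss_sigma l m alpha.
Proof.
by rewrite /lhss_sigma mulr_ge0 // divr_ge0 ?sqrtr_ge0 ?addr_ge0 // ltW.
Qed.

Lemma lhss_sigma_sqr :
  lhss_sigma l m alpha ^+ 2 =
  l ^+ 2 * (alpha ^+ 2 + m ^+ 2) / ((alpha + l) ^+ 2 * m ^+ 2).
Proof.
have al_neq0 : alpha + l != 0 by rewrite gt_eqF // ltr_wpDr.
rewrite /lhss_sigma !exprMn !exprVn sqr_sqrtr ?addr_ge0 ?sqr_ge0 //.
by field; rewrite al_neq0 gt_eqF.
Qed.

(** Phrased through the two half-step equations rather than [lhss_G], so that it applies directly to
    eigenvectors of [G] and to errors of arbitrary iterates. *)
Lemma sqnorm_lhss_step_le (e f e' : 'cV[R[i]]_n) :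
  cmx (alpha%:M + W) *m f = (cmx alpha%:M - 'i%C *: cmx T) *m e ->
  cmx T *m e' = 'i%C *: (cmx W *m f) ->
  sqnorm (cmx T *m e') <= lhss_sigma l m alpha ^+ 2 * sqnorm (cmx T *m e).
Proof.
move=> ef e'f; rewrite e'f sqnormZ normc_sqr /= expr0n expr1n add0r mul1r.
have al2 : 0 < (alpha + l) ^+ 2 by rewrite exprn_gt0 // ltr_wpDr.
rewrite lhss_sigma_sqr mulrAC ler_pdivlMr; last first.
  by apply: mulr_gt0 => //; exact: exprn_gt0.
have := sqnorm_posdef_shift f; rewrite ef => H1.
have := sqnorm_shift_imaginary e => H2.
rewrite mulrA (mulrC (sqnorm _)).
apply: le_trans (_ : l ^+ 2 * (m ^+ 2 * _) <= _).
  by rewrite [leRHS]mulrCA [leLHS]mulrC ler_wpM2l ?sqr_ge0 //; exact: H1.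
by rewrite -[leRHS]mulrA ler_wpM2l ?sqr_ge0.
Qed.

(** * Consequences of the sweep bound: spectral radius, solvability, convergence *)

Hypothesis (TU : T \in unitmx) (WU : alpha%:M + W \in unitmx).

Lemma sqnorm_unitmx_gt0 (e : 'cV[R[i]]_n) : e != 0 -> 0 < sqnorm (cmx T *m e).
Proof.
move=> e0; rewrite lt_neqAle sqnorm_ge0 andbT eq_sym; apply: contra e0 => /eqP.
move/sqnorm_eq0/(congr1 (mulmx (invmx (cmx T)))).
by rewrite mulKmx ?map_unitmx // mulmx0 => /eqP.
Qed.

Lemma eigenvalue_lhss_G_le (z : R[i]) :
  eigenvalue (lhss_G W T alpha) z -> Normc.normc z <= lhss_sigma l m alpha.
Proof.
rewrite -eigenvalue_trmx => /eigenvalueP [u Gu u0].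
have v0 : u^T != 0 by rewrite -trmx0 (inj_eq trmx_inj).
set v := u^T in v0.
have Gv : lhss_G W T alpha *m v = z *: v.
  by apply: trmx_inj; rewrite trmx_mul trmxK Gu linearZ /= trmxK.
(* [f] is the half-step belonging to [v]; the full sweep then ends at [z *: v]. *)
pose f := invmx (cmx (alpha%:M + W)) *m ((cmx alpha%:M - 'i%C *: cmx T) *m v).
have fE : cmx (alpha%:M + W) *m f = (cmx alpha%:M - 'i%C *: cmx T) *m v.
  by rewrite mulKVmx ?map_unitmx.
have Tzv : cmx T *m (z *: v) = 'i%C *: (cmx W *m f).
  rewrite -Gv /lhss_G -scalemxAl -scalemxAr -!mulmxA.
  by rewrite mulKVmx ?map_unitmx.
have := sqnorm_lhss_step_le fE Tzv.
rewrite -scalemxAr sqnormZ ler_pM2r ?sqnorm_unitmx_gt0 //.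
by rewrite ler_pXn2r ?nnegrE ?normc_ge0 ?lhss_sigma_ge0.
Qed.

Lemma lhss_spectral_radius_le :
  spectral_radius (lhss_G W T alpha) <= lhss_sigma l m alpha.
Proof.
rewrite /spectral_radius; set S := (X in sup X).
(* The supremum of the empty set is 0 by convention. *)
have [->|/set0P S0] := eqVneq S set0; first by rewrite sup0 lhss_sigma_ge0.
by apply: ge_sup => // _ [z /= Gz <-]; exact: eigenvalue_lhss_G_le.
Qed.

Lemma lhss_sqnorm_iter (x xh : nat -> 'cV[R[i]]_n) (b x0 xs : 'cV[R[i]]_n) k :
  lhss_matrix W T *m xs = b -> lhss_iterates W T alpha b x0 x xh ->
  sqnorm (cmx T *m (x k - xs)) <=
  (lhss_sigma l m alpha ^+ 2) ^+ k * sqnorm (cmx T *m (x0 - xs)).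
Proof.
move=> Axs [x00 xk].
have Wxs : cmx (alpha%:M + W) *m xs =
    (cmx alpha%:M - 'i%C *: cmx T) *m xs + b.
  rewrite -Axs /lhss_matrix -mulmxDl /cmx map_mxD; congr (_ *m _).
  by rewrite [cmx W + _]addrC addrA addrNK.
have Txs : cmx T *m xs = 'i%C *: (cmx W *m xs) - 'i%C *: b.
  rewrite -Axs /lhss_matrix mulmxDl scalerDr opprD addNKr -scalemxAl scalerA.
  by rewrite -expr2 sqr_i scaleN1r opprK.
elim: k => [|k IHk]; first by rewrite expr0 mul1r x00.
have [xhk xk1] := xk k.
rewrite exprS -mulrA; apply: le_trans (ler_wpM2l (sqr_ge0 _) IHk).
apply: (@sqnorm_lhss_step_le _ (xh k - xs)); rewrite !mulmxBr.
  by rewrite xhk Wxs opprD addrACA subrr addr0.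
by rewrite xk1 Txs scalerBr opprB addrA addrNK.
Qed.

Lemma lhss_solution_unique (y : 'cV[R[i]]_n) :
  lhss_sigma l m alpha < 1 -> lhss_matrix W T *m y = 0 -> y = 0.
Proof.
move=> s1 Ay; apply/eqP; apply: contraT => /sqnorm_unitmx_gt0 Ty.
(* For [b = 0] a kernel vector is a constant run; its first step, compared with the solution 0,
   contradicts strict contraction. *)
have it : lhss_iterates W T alpha 0 y (fun=> y) (fun=> y).
  split=> // _; rewrite scaler0 subr0 addr0; split.
    apply/eqP; rewrite -subr_eq0 -mulmxBl -Ay /lhss_matrix; apply/eqP.
    congr (_ *m _); rewrite /cmx map_mxD opprB.
    by rewrite addrCA [map_mx _ _ + _]addrC addrK addrC.
  have := congr1 ( *:%R 'i%C) Ay; rewrite /lhss_matrix mulmxDl scaler0 scalerDr.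
  rewrite -!scalemxAl scalerA -expr2 sqr_i scaleN1r => /eqP.
  by rewrite subr_eq0 => /eqP.
have := lhss_sqnorm_iter 1 (mulmx0 _ _) it.
rewrite subr0 expr1 ler_pMl // leNgt expr_lt1 ?lhss_sigma_ge0 //.
by rewrite s1.
Qed.

Lemma lhss_convergent_lt1 :
  lhss_sigma l m alpha < 1 -> lhss_convergent W T alpha.
Proof.
move=> s1 b x0.
have AU : lhss_matrix W T \in unitmx.
  (* Transposed rows of the kernel of the transpose of [A] are column vectors killed by [A]. *)
  rewrite -unitmx_tr -row_free_unit -kermx_eq0; apply/eqP/row_matrixP => i.
  rewrite row0; apply: trmx_inj; rewrite trmx0; apply: lhss_solution_unique => //.
  apply: trmx_inj; rewrite trmx_mul trmxK trmx0.
  by apply/sub_kermxP; exact: row_sub.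
have Axs : lhss_matrix W T *m (invmx (lhss_matrix W T) *m b) = b.
  by rewrite mulKVmx.
set xs := _ *m b in Axs; exists xs; split.
- by split=> // y Ay; apply: (can_inj (mulKmx AU)); rewrite Axs Ay.
- pose h y := invmx (cmx (alpha%:M + W)) *m
                ((cmx alpha%:M - 'i%C *: cmx T) *m y + b).
  pose g y := invmx (cmx T) *m ('i%C *: (cmx W *m h y) - 'i%C *: b).
  exists (fun k => iter k g x0), (fun k => h (iter k g x0)); split=> // k.
  by rewrite /g /h !mulKVmx ?map_unitmx.
move=> x xh it.
pose q := lhss_sigma l m alpha.
have q0 : 0 <= q by exact: lhss_sigma_ge0.
(* The division by [m] comes from [sqnorm_symmetric_ge]. *)
pose C := Num.sqrt (sqnorm (cmx T *m (x0 - xs))) / m.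
have bound k i : Normc.normc (x k i 0 - xs i 0) <= C * q ^+ k.
  have C0 : 0 <= C by rewrite divr_ge0 ?sqrtr_ge0 ?ltW.
  rewrite -(ler_pXn2r (n := 2%N)) ?nnegrE ?normc_ge0 ?(mulr_ge0 C0) ?exprn_ge0 //.
  rewrite exprMn /C expr_div_n sqr_sqrtr ?sqnorm_ge0 // mulrAC.
  rewrite ler_pdivlMr ?exprn_gt0 // mulrC.
  apply: le_trans (_ : m ^+ 2 * sqnorm (x k - xs) <= _).
    rewrite ler_wpM2l ?sqr_ge0 //.
    by have := normc_sqr_le_sqnorm (x k - xs) i; rewrite !mxE.
  apply: le_trans (sqnorm_symmetric_ge _) _.
  by rewrite mulrC exprAC; exact: lhss_sqnorm_iter it.
have cvC : ((fun k => C * q ^+ k) @ \oo --> (0 : R))%classic.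
  by apply: cvg_geometric; rewrite ger0_norm.
(* Matrix neighbourhoods are given entrywise by [P]; as there are finitely many entries, convergence
   of each one suffices. *)
move=> A [P Pxs PA]; rewrite /nbhs /=.
suff : (\forall k \near \oo,
    forall ij : 'I_n * 'I_1, P ij.1 ij.2 (x k ij.1 ij.2))%classic.
  by apply: filterS => k Pk; apply: PA => i j; exact: (Pk (i, j)).
apply: filter_forall => -[i j] /=; rewrite (ord1 j).
suff : ((fun k => x k i 0 : R[i]^o) @ \oo --> (xs i 0 : R[i]^o))%classic.
  by move=> cv; apply: (cv (P i 0)); exact: Pxs.
apply/cvgrPdistC_lt => eps eps0.
(* A positive element of [R[i]] is real, so the real geometric bound can be tested against its real
   part. *)
have epsE : eps = real_complex R (complex.Re eps) by rewrite RRe_real // gtr0_real.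
move/cvgrPdist_lt : cvC => /(_ (complex.Re eps)).
rewrite -ltcR -epsE => /(_ eps0); apply: filterS => k /= Ck.
rewrite epsE [ltLHS](_ : _ = real_complex R (Normc.normc (x k i 0 - xs i 0))) //.
rewrite ltcR; apply: le_lt_trans (bound k i) _.
apply: le_lt_trans Ck; rewrite sub0r normrN; exact: ler_norm.
Qed.

End Step.

(** After squaring and clearing denominators, the terms in [l ^+ 2 * m ^+ 2] cancel and a factor
    [alpha > 0] splits off, leaving a condition linear in [alpha]. *)
Lemma lhss_sigma_lt1 (R : realType) (l m alpha : R) :
  0 < l -> 0 < m -> 0 < alpha ->
  (lhss_sigma l m alpha < 1) =
  (alpha * (l ^+ 2 - m ^+ 2) < 2 * l * m ^+ 2).
Proof.
move=> l0 m0 al0.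
have s0 : 0 <= lhss_sigma l m alpha by apply: lhss_sigma_ge0 => //; exact: ltW.
rewrite -(ltr_pXn2r (n := 2%N)) ?nnegrE // expr1n lhss_sigma_sqr ?ltW //.
rewrite ltr_pdivrMr ?mul1r; last by rewrite mulr_gt0 // exprn_gt0 // addr_gt0.
rewrite -subr_gt0 -[RHS]subr_gt0 -(pmulr_rgt0 _ al0); congr (0 < _); ring.
Qed.

Theorem theorem2p1 (R : realType) (n : nat) (W T : 'M[R]_n) (lmax mmin : R)
    (W_posdef : sym_posdef W)
    (T_indef : sym_indefinite T)
    (T_nonsing : T \in unitmx)
    (lmaxP : largest_eigenvalue W lmax)
    (mminP : smallest_abs_eigenvalue T mmin) :
  [/\ forall alpha : R, 0 < alpha ->
        spectral_radius (lhss_G W T alpha) <= lhss_sigma lmax mmin alpha,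
      lmax <= mmin ->
        forall alpha : R, 0 < alpha ->
          lhss_sigma lmax mmin alpha < 1 /\ lhss_convergent W T alpha
    & mmin < lmax ->
        forall alpha : R, 0 < alpha ->
          (lhss_sigma lmax mmin alpha < 1 <->
             alpha \in `]0, (2 * lmax * mmin ^+ 2 / (lmax ^+ 2 - mmin ^+ 2))[)
          /\
          (alpha \in `]0, (2 * lmax * mmin ^+ 2 / (lmax ^+ 2 - mmin ^+ 2))[ ->
             lhss_convergent W T alpha)].
Proof.
have [symW _] := W_posdef; have [symT _ _] := T_indef.
have [eigl lub] := lmaxP; have [[mu eigmu muE] mlb] := mminP.
have l0 : 0 < lmax by exact: posdef_eigenvalue_gt0 eigl.
have m0 : 0 < mmin.
  by rewrite -muE normr_gt0; exact: unitmx_eigenvalue_neq0 eigmu.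
have eigW a : eigenvalue W a -> 0 <= a <= lmax.
  by move=> Wa; rewrite lub // ltW // (posdef_eigenvalue_gt0 W_posdef Wa).
have cvg alpha : 0 < alpha -> lhss_sigma lmax mmin alpha < 1 ->
    lhss_convergent W T alpha.
  move=> al0; apply: lhss_convergent_lt1 => //; first exact: ltW.
  exact: posdef_shift_unitmx.
split=> [alpha al0|lm alpha al0|ml alpha al0].
- apply: lhss_spectral_radius_le => //; first exact: ltW.
  exact: posdef_shift_unitmx.
- suff s1 : lhss_sigma lmax mmin alpha < 1 by split=> //; exact: cvg.
  (* Here [lmax ^+ 2 - mmin ^+ 2 <= 0], so 0 separates the two sides. *)
  rewrite lhss_sigma_lt1 //; apply: le_lt_trans (_ : 0 < _).
    by rewrite pmulr_rle0 // subr_le0 ler_pXn2r ?nnegrE // ltW.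
  by rewrite !mulr_gt0 ?exprn_gt0.
- have d0 : 0 < lmax ^+ 2 - mmin ^+ 2.
    by rewrite subr_gt0 ltr_pXn2r ?nnegrE // ltW.
  have sE : lhss_sigma lmax mmin alpha < 1 =
      (alpha \in `]0, (2 * lmax * mmin ^+ 2 / (lmax ^+ 2 - mmin ^+ 2))[).
    by rewrite lhss_sigma_lt1 // in_itv /= al0 ltr_pdivlMr.
  by rewrite -sE; split=> //; exact: cvg.
Qed.
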